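(* Let $H$ be Hall's universal locally finite group. Then $Inn(H)$ is the locally finite radical of $Aut(H)$, i.e. $Inn(H)$ is the largest locally finite normal subgroup of $Aut(H)$: $Inn(H)$ is a locally finite normal subgroup of $Aut(H)$, and every locally finite normal subgroup of $Aut(H)$ is contained in $Inn(H)$.
   Context: Hall's universal locally finite group $H$ is the group, unique up to isomorphism, such that: (A) $H$ is countable; (B) $H$ is locally finite (every finitely generated subgroup is finite); (C) every finite group embeds into $H$; (D) any two isomorphic finite subgroups of $H$ are conjugate in $H$. $Aut(H)$ denotes the group of all automorphisms of $H$ and $Inn(H)$ its subgroup of inner automorphisms. *)

(* Defs.v *)
From HB Require Import structures.
From mathcomp Require Import all_boot fingroup.
From mathcomp Require Import boolp classical_sets functions cardinality.

Set Implicit Arguments.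
Unset Strict Implicit.
Unset Printing Implicit Defensive.

Local Open Scope classical_set_scope.
Local Open Scope group_scope.

Section Subgroups.
Variable G : groupType.
Implicit Types K L S N R : set G.

Definition subgroup K : Prop := group_closed [in K].

Lemma subgroupP K :
  subgroup K <-> K 1 /\ forall x y, K x -> K y -> K (x / y).
Proof.
split=> -[K1 KV]; split; first by move: K1; rewrite inE.
- by move=> x y Kx Ky; have := KV x y; rewrite !inE; apply.
- by rewrite inE.
- by move=> x y; rewrite !inE; apply: KV.
Qed.

Definition normal_subgroup N : Prop :=
  subgroup N /\ forall x g, N x -> N (x ^ g).

Definition generated_subgroup S : set G := smallest subgroup S.

Definition finitely_generated L : Prop :=
  exists2 S, finite_set S & L = generated_subgroup S.

(* For a subgroup K, the finitely generated subgroups of K are exactly the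
   finitely generated subgroups of G contained in K. *)
Definition locally_finite K : Prop :=
  forall L, finitely_generated L -> L `<=` K -> finite_set L.

Definition isomorphic_subgroups K L : Prop :=
  exists2 f : G -> G, set_bij K L f & {in K &, {morph f : x y / x * y}}.

Definition conjugate_subgroups K L : Prop := exists g, L = [set x ^ g | x in K].

Definition is_locally_finite_radical R : Prop :=
  [/\ normal_subgroup R, locally_finite R &
      forall N, normal_subgroup N -> locally_finite N -> N `<=` R].

End Subgroups.

Record is_hall_universal (H : groupType) : Prop := IsHallUniversal {
  hall_countable : countable [set: H];
  hall_locally_finite : locally_finite [set: H];
  hall_embeds : forall F : finGroupType,
    exists f : {multiplicative F -> H}, injective f;
  hall_conjugate : forall K L : set H, subgroup K -> subgroup L ->
    finite_set K -> finite_set L -> isomorphic_subgroups K L -> conjugate_subgroups K L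
}.

Record autType (G : groupType) := MkAut {
  aut_fun :> G -> G;
  autM : {morph aut_fun : x y / x * y};
  aut_bij : bijective aut_fun
}.

Section AutGroup.
Variable G : groupType.
Implicit Types f g h : autType G.

Lemma autP f g : f =1 g -> f = g.
Proof.
case: f g => [f fM fb] [g gM gb] /= /funext fg; subst g.
by rewrite (Prop_irrelevance fM gM) (Prop_irrelevance fb gb).
Qed.

Lemma aut_inv_exists f : exists g, cancel f g /\ cancel g f.
Proof.
case: (aut_bij f) => g fK gK.
have gM : {morph g : x y / x * y}.
  by move=> x y; apply: (can_inj fK); rewrite autM !gK.
by exists (MkAut gM (Bijective gK fK)).
Qed.

Definition aut_inv f : autType G := projT1 (cid (aut_inv_exists f)).

Lemma aut_invK f : cancel f (aut_inv f).
Proof. by rewrite /aut_inv; case: cid => g []. Qed.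

Lemma aut_invKV f : cancel (aut_inv f) f.
Proof. by rewrite /aut_inv; case: cid => g []. Qed.

Definition aut_one : autType G :=
  @MkAut G idfun (fun _ _ => erefl) (Bijective (fun=> erefl) (fun=> erefl)).

Lemma aut_comp_morph f g : {morph g \o f : x y / x * y}.
Proof. by move=> x y /=; rewrite !autM. Qed.

(* As for {perm _}, the product f * g applies f first, so that conjugation
   x |-> x ^ g is a homomorphism in g. *)
Definition aut_mul f g : autType G :=
  MkAut (aut_comp_morph f g) (bij_comp (aut_bij g) (aut_bij f)).

Lemma aut_mulA : associative aut_mul.
Proof. by move=> f g h; apply: autP. Qed.
Lemma aut_1mul : left_id aut_one aut_mul.
Proof. by move=> f; apply: autP. Qed.
Lemma aut_mul1 : right_id aut_one aut_mul.
Proof. by move=> f; apply: autP. Qed.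
Lemma aut_mulV : left_inverse aut_one aut_inv aut_mul.
Proof. by move=> f; apply: autP => x; exact: aut_invKV. Qed.
Lemma aut_mulrV : right_inverse aut_one aut_inv aut_mul.
Proof. by move=> f; apply: autP => x; exact: aut_invK. Qed.

HB.instance Definition _ := gen_eqMixin (autType G).
HB.instance Definition _ := gen_choiceMixin (autType G).
HB.instance Definition _ := isGroup.Build (autType G)
  aut_mulA aut_1mul aut_mul1 aut_mulV aut_mulrV.

Lemma conj_morph (g : G) : {morph (fun x => x ^ g) : x y / x * y}.
Proof. by move=> x y; rewrite conjMg. Qed.

Lemma conj_bij (g : G) : bijective (fun x : G => x ^ g).
Proof. by exists (fun x => x ^ g^-1) => x; rewrite -conjgM ?mulgV ?mulVg conjg1. Qed.

Definition inner_aut (g : G) : autType G := MkAut (conj_morph g) (conj_bij g).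

Definition Inn : set (autType G) := range inner_aut.

End AutGroup.

Arguments Inn : clear implicits.

(* Main.v *)
Require Import Defs.
From HB Require Import structures.
From mathcomp Require Import all_boot fingroup perm.
From mathcomp Require Import boolp classical_sets functions cardinality.

Set Implicit Arguments.
Unset Strict Implicit.
Unset Printing Implicit Defensive.

Local Open Scope classical_set_scope.
Local Open Scope group_scope.

(** Conjugation maps [H] onto [Inn H], so [Inn H] is normal and inherits
    local finiteness from [H]. The substance is maximality: if [N] is a
    normal subgroup of [Aut H] and [f] in [N] is not inner, then [N]
    contains an element of infinite order. One may assume that [f] has
    finite order, so that finite sets generate finite [f]-invariant
    subgroups.

    The element is [ [~ (f ^ g1)^-1 * f ^ g0, f^-1 * f ^ g2] ] for suitable
    automorphisms [g0], [g1], [g2]. When [g] is conjugation by [k], the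
    conjugate [f ^ g] is [f] followed by conjugation by the displacement [u
    k := (f k)^-1 * k]; so for inner [gi] the element above is conjugation
    by [ [~ (u k1)^-1 * u k0, u k2] ]. This has finite order, but for each
    [M > 0] its [M]-th power can be made nontrivial, even after the action
    of the [ki] on a finite set has been prescribed
    ([displacement_commutator_order]). Since [H] is countable, a
    construction in the style of Baire category ([generic_automorphisms])
    glues finite approximations [ki] into automorphisms [gi] for which no
    power is trivial.

    To make an [M]-th power nontrivial, fix a finite [f]-invariant subgroup
    [A] and let the [ki] vary modulo the centralizer [C(A)]. The only access
    to [f z], for [z] in [C(A)], is that it centralizes [f x] whenever [z]
    centralizes [x]. So if [t = f x] and [z] centralizes [A] and [x], then
    [t ^ u z = t ^ z] and [ [~ t, u z] = [~ t, z] ]. When [t] is outside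
    [<A, x>] such a [z] can be chosen with [ [~ t, z] ^+ M ] nontrivial
    ([free_centralizer]: in a finite group of permutations of copies of [<A,
    x, t>], [z] permutes the copies of each point, by a permutation that
    only has to be constant along each coset of [<A, x>]). What is needed is
    therefore a [t] of the form [(u z2)^-1 * u z1] outside [<A, f^-1 t>],
    that is with [f t] outside [<A, t>]. The elements [(u z2)^-1 * u z1]
    include all conjugates under [C(A)] of a displacement [u z0]. If each
    such [t] satisfied [f t \in <A, t>], then all displacements, hence also
    these conjugates, would normalize [<A, u z0>]; this contradicts
    [free_centralizer] once [u z0] is outside [A].

    Finally a displacement outside [A] exists because [f] is outer: an
    automorphism that fixes [C(A)] pointwise is inner
    ([centralizer_fixed_inner]), by conjugating [A] to an [A ^ s] that
    commutes with a given finite subgroup, and because finite subgroups of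
    [H] are their own double centralizers. *)

(** * Subgroups and centralizers *)

Section SubgroupTheory.
Variable G : groupType.
Implicit Types (K L S : set G) (x y z : G).

Lemma subgroup1 K : subgroup K -> K 1.
Proof. by case/subgroupP. Qed.

Lemma subgroupF K x y : subgroup K -> K x -> K y -> K (x / y).
Proof. by case/subgroupP=> _; apply. Qed.

Lemma subgroupV K x : subgroup K -> K x -> K x^-1.
Proof.
by move=> gK Kx; rewrite -div1g; apply: subgroupF => //; apply: subgroup1.
Qed.

Lemma subgroupM K x y : subgroup K -> K x -> K y -> K (x * y).
Proof.
move=> gK Kx Ky; rewrite -[y]invgK.
by apply: subgroupF => //; apply: subgroupV.
Qed.

Lemma subgroupX K x n : subgroup K -> K x -> K (x ^+ n).
Proof.
move=> gK Kx; elim: n => [|n IHn]; first by rewrite expg0; apply: subgroup1.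
by rewrite expgS; apply: subgroupM.
Qed.

Lemma subgroupJ K x y : subgroup K -> K x -> K y -> K (x ^ y).
Proof.
move=> gK Kx Ky; rewrite conjgE; do 2?apply: subgroupM => //.
exact: subgroupV.
Qed.

Lemma subgroupR K x y : subgroup K -> K x -> K y -> K [~ x, y].
Proof.
move=> gK Kx Ky; rewrite commgEl.
by apply: subgroupM => //; [apply: subgroupV | apply: subgroupJ].
Qed.

Lemma subgroup_generated S : subgroup (generated_subgroup S).
Proof.
apply/subgroupP; split=> [K [gK _]|x y Sx Sy K KP]; first exact: subgroup1.
by apply: (subgroupF KP.1); [apply: Sx | apply: Sy].
Qed.

Lemma sub_generated S : S `<=` generated_subgroup S.
Proof. exact: sub_gen_smallest. Qed.

Lemma generated_sub S K : subgroup K -> S `<=` K -> generated_subgroup S `<=` K.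
Proof. exact: smallest_sub. Qed.

Definition centralizer S : set G := [set z | forall a, S a -> a ^ z = a].

Lemma subgroup_centralizer S : subgroup (centralizer S).
Proof.
apply/subgroupP; split=> [a _|z w Cz Cw a Sa]; first by rewrite conjg1.
by rewrite conjgM Cz // -{1}(Cw a Sa) conjgK.
Qed.

Lemma centralizerS S L z : S `<=` L -> centralizer L z -> centralizer S z.
Proof. by move=> SL Cz a /SL; apply: Cz. Qed.

Lemma centralizer_sym z x : x ^ z = x -> z ^ x = z.
Proof. by move/conjg_fixP; rewrite commg1_sym => /conjg_fixP. Qed.

Lemma commgMM_centralizer S a b t w :
    S a -> S b -> centralizer S t -> centralizer S w ->
  [~ a * t, b * w] = [~ a, b] * [~ t, w].
Proof.
move=> Sa Sb Ct Cw; have tb : t ^ b = t by apply: centralizer_sym; apply: Ct.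
have abw : (a ^ b) ^ w = a ^ b by rewrite conjJg !Cw.
have tab : t^-1 * [~ a, b] = [~ a, b] * t^-1.
  apply/esym/commuteV/commute_sym/commgP/conjg_fixP/centralizer_sym.
  by rewrite conjRg !Ct.
rewrite commgEl conjgM conjMg tb conjMg abw invMg -mulgA (mulgA a^-1).
by rewrite -(commgEl a b) (mulgA t^-1) tab -mulgA -(commgEl t w).
Qed.

End SubgroupTheory.

Section MultiplicativeFunctions.
Variables (G K : groupType) (f : G -> K).
Hypothesis fM : {morph f : x y / x * y}.

Let f_divg : {morph f : x y / x / y}.
Proof. by move=> x y; apply: (canRL (mulgK _)); rewrite -fM mulgVK. Qed.

Let F : UMagmaMorphism.type G K :=
  HB.pack f (isGroupMorphism.Build G K f f_divg).

Lemma mulmorph1 : f 1 = 1. Proof. exact: (gmulf1 (s := F)). Qed.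
Lemma mulmorphV : {morph f : x / x^-1}. Proof. exact: (gmulfV F). Qed.
Lemma mulmorphF : {morph f : x y / x / y}. Proof. exact: (gmulfF F). Qed.
Lemma mulmorphX n : {morph f : x / x ^+ n}. Proof. exact: (gmulfXn F). Qed.
Lemma mulmorphJ : {morph f : x y / x ^ y}. Proof. exact: (gmulfJ F). Qed.
Lemma mulmorphR : {morph f : x y / [~ x, y]}. Proof. exact: (gmulfR F). Qed.

Lemma subgroup_image (L : set G) : subgroup L -> subgroup (f @` L).
Proof.
move=> gL; apply/subgroupP; split=> [|_ _ [x Lx <-] [y Ly <-]].
  by exists 1; [apply: subgroup1 | rewrite mulmorph1].
by exists (x / y); [apply: subgroupF | rewrite mulmorphF].
Qed.

Lemma subgroup_range : subgroup (range f).
Proof. by apply: subgroup_image; apply/subgroupP. Qed.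

Lemma subgroup_preimage (L : set K) : subgroup L -> subgroup (f @^-1` L).
Proof.
move=> gL; apply/subgroupP; split=> [|x y] /=.
  by rewrite mulmorph1; apply: subgroup1.
by rewrite mulmorphF; apply: subgroupF.
Qed.

End MultiplicativeFunctions.

Lemma finite_injection_onto (T : eqType) (Q : set T) (phi : T -> T) y :
    finite_set Q -> injective phi -> (forall x, Q x -> Q (phi x)) -> Q y ->
  exists2 x, Q x & phi x = y.
Proof.
move=> /finite_seqP[s ->] phi_inj sphi sy.
have sub : {subset map phi (undup s) <= undup s}.
  by move=> _ /mapP[x + ->]; rewrite !mem_undup; apply: sphi.
have uphi : uniq (map phi (undup s)) by rewrite map_inj_uniq ?undup_uniq.
have [|_ eqs] := uniq_min_size uphi sub; first by rewrite size_map.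
have /mapP[x sx ->] : y \in map phi (undup s) by rewrite eqs mem_undup.
by exists x => //=; rewrite -mem_undup.
Qed.

Lemma locally_finite_torsion (G : groupType) (K : set G) x :
    subgroup K -> locally_finite K -> K x ->
  exists2 n, 0 < n & x ^+ n = 1.
Proof.
move=> gK lfK Kx.
have /finite_seqP[s xs] : finite_set (generated_subgroup [set x]).
  apply: lfK; first by exists [set x].
  by apply: generated_sub => // _ ->.
have sx i : x ^+ i \in s.
  suff : generated_subgroup [set x] (x ^+ i) by rewrite xs.
  exact: (subgroupX _ (subgroup_generated _) (@sub_generated _ _ _ _)).
pose l := [seq x ^+ i | i <- iota 0 (size s).+1].
have : ~~ uniq l.
  apply/negP=> uniq_l; suff: size l <= size s.
    by rewrite size_map size_iota ltnn.
  by apply: uniq_leq_size => // _ /mapP[i _ ->].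
case/(uniqPn 1)=> i [j [lt_ij]]; rewrite size_map size_iota => lt_j.
have lt_i := ltn_trans lt_ij lt_j.
rewrite !(nth_map 0) ?size_iota // !nth_iota // => eq_x.
exists (j - i); first by rewrite subn_gt0.
by rewrite expgnFr 1?ltnW // eq_x mulgV.
Qed.

(** * Finite subgroups as finite groups *)

(** The closure proof is a parameter of the type so that the group structure
    below can be attached to it. *)
Definition seq_group (G : groupType) (s : seq G)
  & group_closed [in s] : Type := seq_sub s.

Section SeqGroup.
Variables (G : groupType) (s : seq G) (sG : group_closed [in s]).

HB.instance Definition _ := SubFinite.copy (seq_group sG) (seq_sub s).
HB.instance Definition _ :=
  SubChoice_isSubGroup.Build G (mem s) (seq_group sG) sG.
End SeqGroup.

Lemma finite_subgroup_range (G : groupType) (B : set G) :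
  subgroup B -> finite_set B ->
  exists (F : finGroupType) (b : F -> G),
    [/\ {morph b : x y / x * y}, injective b & range b = B].
Proof.
move=> gB /finite_seqP[s Bs].
have sG : group_closed [in s].
  have [B1 BF] := (subgroupP B).1 gB; move: B1 BF; rewrite Bs => s1 sF.
  by split=> // x y; apply: sF.
exists (seq_group sG), (val : seq_group sG -> G).
split; [exact: valM | exact: val_inj | ].
rewrite Bs; apply/seteqP; split=> [_ [x _ <-]|x sx] /=; first exact: ssvalP.
by exists (SeqSub sx).
Qed.

(** * Permutations of copies of a finite group *)

Section PermutationModel.
Variables (F : finGroupType) (I : finType).
Implicit Types (a b x : F) (i : I).

Lemma right_transl_inj b : injective (fun p : F * I => (p.1 * b, p.2)).
Proof. by case=> x i [y j] [/mulIg-> ->]. Qed.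
Definition right_transl b : {perm F * I} := perm (@right_transl_inj b).

Lemma right_translE b x i : right_transl b (x, i) = (x * b, i).
Proof. by rewrite permE. Qed.

Lemma right_translM : {morph right_transl : a b / a * b}.
Proof.
by move=> a b; apply/permP=> -[x i]; rewrite permM !right_translE mulgA.
Qed.

Lemma left_transl_inj a : injective (fun p : F * I => (a^-1 * p.1, p.2)).
Proof. by case=> x i [y j] [/mulgI-> ->]. Qed.
(** The inverse makes the map multiplicative, since products of permutations
    apply the left factor first. *)
Definition left_transl a : {perm F * I} := perm (@left_transl_inj a).

Lemma left_translE a x i : left_transl a (x, i) = (a^-1 * x, i).
Proof. by rewrite permE. Qed.

Lemma left_translM : {morph left_transl : a b / a * b}.
Proof.
by move=> a b; apply/permP=> -[x i]; rewrite permM !left_translE invMg mulgA.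
Qed.

Lemma fibre_perm_inj (s : F -> {perm I}) :
  injective (fun p : F * I => (p.1, s p.1 p.2)).
Proof. by case=> x i [y j] [-> /perm_inj->]. Qed.
Definition fibre_perm s : {perm F * I} := perm (@fibre_perm_inj s).

Lemma fibre_permE s x i : fibre_perm s (x, i) = (x, s x i).
Proof. by rewrite permE. Qed.

Lemma fibre_permM (s s' : F -> {perm I}) :
  fibre_perm s * fibre_perm s' = fibre_perm (fun x => s x * s' x).
Proof. by apply/permP=> -[x i]; rewrite permM !fibre_permE permM. Qed.

Lemma fibre_permV (s : F -> {perm I}) :
  (fibre_perm s)^-1 = fibre_perm (fun x => (s x)^-1).
Proof.
apply: mulg1_eq; rewrite fibre_permM; apply/permP=> -[x i].
by rewrite fibre_permE mulgV !perm1.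
Qed.

Lemma fibre_permX (s : F -> {perm I}) n :
  fibre_perm s ^+ n = fibre_perm (fun x => s x ^+ n).
Proof.
elim: n => [|n IHn]; last first.
  rewrite expgS IHn fibre_permM; congr fibre_perm.
  by apply/funext=> x; rewrite expgS.
by apply/permP=> -[x i]; rewrite fibre_permE !expg0 !perm1.
Qed.

(** The commutator is supported on the fibres because the two translations
    in it cancel: this is what makes its powers computable. *)
Lemma commg_right_transl_fibre t (s : F -> {perm I}) :
  [~ right_transl t, fibre_perm s] = fibre_perm (fun x => (s (x / t))^-1 * s x).
Proof.
rewrite commgEl conjgE fibre_permV -(mulmorphV right_translM).
apply/permP=> -[x i].
by rewrite !permM !(right_translE, fibre_permE) mulgVK permM.
Qed.

End PermutationModel.

Lemma rotation_exists n : 0 < n -> exists s : {perm 'I_n.+1}, s ^+ n != 1.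
Proof.
move=> n_gt0; exists (perm (bij_inj (@ordS_bij n.+1))).
apply/eqP=> /permP/(_ ord0); rewrite perm1 permX.
have iterE m : m <= n ->
    iter m (perm (bij_inj (@ordS_bij n.+1))) ord0 = m :> nat.
  elim: m => //= m IHm lt_mn; rewrite permE /= IHm 1?ltnW //.
  by rewrite modn_small.
by move/(congr1 val); rewrite /= iterE // => n0; rewrite n0 in n_gt0.
Qed.

Arguments right_transl {F} I b.
Arguments left_transl {F} I a.

(** * Embedding finite permutation groups over a finite subgroup *)

Section HallEmbeddings.
Variables (H : groupType) (hallH : is_hall_universal H).

Lemma hall_generated_finite (S : set H) :
  finite_set S -> finite_set (generated_subgroup S).
Proof. by move=> Sfin; apply: (hall_locally_finite hallH) => //; exists S. Qed.

(** Embed [{perm F * I}] somewhere in [H]. The image of the translations is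
    isomorphic to [b]'s image, hence conjugate to it, but conjugate by an
    element that may induce an automorphism [al] of [F] instead of the
    identity; [al] acts on [F * I] through the first factor, and conjugation
    by this permutation undoes it. *)
Lemma permutation_model (F : finGroupType) (b : F -> H) (I : finType) :
    {morph b : x y / x * y} -> injective b -> 0 < #|I| ->
  exists phi : {perm F * I} -> H,
    [/\ {morph phi : p q / p * q}, injective phi &
      forall x, phi (right_transl I x) = b x].
Proof.
move=> bM b_inj /card_gt0P[i0 _].
have [psi psi_inj] := hall_embeds hallH {perm F * I}.
pose r x := psi (right_transl I x).
have rM : {morph r : x y / x * y}.
  by move=> x y; rewrite /r right_translM gmulfM.
have r_inj : injective r.
  move=> x y /psi_inj/permP/(_ (1, i0)).
  by rewrite !right_translE !mul1g => -[].
have [bV bK] : exists bV, cancel b bV.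
  have /choice[bV bVP] y : exists x, range b y -> b x = y.
    by case: (pselect (range b y)) => [[x _ <-]|]; [exists x | exists 1].
  by exists bV => x; apply: b_inj; apply: bVP; exists x.
have bVK y : range b y -> b (bV y) = y by case=> x _ <-; rewrite bK.
have [|||g rg] :=
    hall_conjugate hallH (subgroup_range bM) (subgroup_range rM).
- exact: finite_image finite_finset.
- exact: finite_image finite_finset.
- exists (r \o bV); last first.
    move=> x y; rewrite !inE => -[u _ <-] [v _ <-] /=.
    by rewrite -bM !bK rM.
  split.
  - by move=> _ [x _ <-] /=; rewrite bK; exists x.
  - move=> y z; rewrite !inE => -[u _ <-] [v _ <-] /=.
    by rewrite !bK => /r_inj->.
  - by move=> _ [x _ <-]; exists (b x); [exists x | rewrite /= bK].
(* The automorphism of F by which psi, once conjugated by g, differs from b. *)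
pose al x := bV (r x ^ g^-1).
have alE x : b (al x) = r x ^ g^-1.
  rewrite bVK //; have [] : [set x ^ g | x in range b] (r x).
    by rewrite -rg; exists x.
  by move=> y by_ <-; rewrite conjgK.
have alM : {morph al : x y / x * y}.
  by move=> x y; apply: b_inj; rewrite bM !alE rM conjMg.
have al_inj : injective al.
  by move=> x y /(congr1 b); rewrite !alE => /conjg_inj/r_inj.
have a_inj : injective (fun p : F * I => (al p.1, p.2)).
  by case=> x i [y j] [/al_inj-> ->].
pose a := perm a_inj.
pose phi p := psi (p ^ a^-1) ^ g^-1.
have phiM : {morph phi : p q / p * q}.
  by move=> p q; rewrite /phi conjMg gmulfM conjMg.
exists phi; split=> // [p q|x].
  by move/conjg_inj/psi_inj/conjg_inj.
have [y ->] : exists y, x = al y.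
  by exists (invF al_inj x); rewrite f_invF.
rewrite alE /phi /r; congr (psi _ ^ _).
apply: (canLR (conjgK _)); apply: (canRL (mulKg _)).
by apply/permP=> -[z i]; rewrite !permM right_translE !permE /= alM.
Qed.

(** Read in [{perm F * I}], where [F] is [B] and [I] is a cycle of length
    [2M + 1]: [z] rotates the fibres over [B0] and fixes the others. It
    commutes with [B0], and [ [~ t, z] ] rotates the fibre over [1] forwards
    and the fibre over [t] backwards. Hence the conjugate of [t] in the
    statement moves the second coordinate, which no element of [B] does.

    In particular the [M]-th power is nontrivial and does not normalize [B]. *)
Lemma free_centralizer (B0 B : set H) (t : H) (M : nat) :
    subgroup B0 -> subgroup B -> finite_set B -> B0 `<=` B ->
    B t -> ~ B0 t -> 0 < M ->
  exists2 z, centralizer B0 z & ~ B (t ^ ([~ t, z] ^+ M)).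
Proof.
move=> gB0 gB finB sB0B.
have [F [b [bM b_inj rbB]]] := finite_subgroup_range gB finB.
rewrite -rbB => -[tau _ <-{t}] B0't M_gt0.
have [s s_neq1] : exists s : {perm 'I_(M + M).+1}, s ^+ (M + M) != 1.
  by apply: rotation_exists; rewrite addn_gt0 M_gt0.
have [|phi [phiM phi_inj phiE]] :=
    permutation_model (I := 'I_(M + M).+1) bM b_inj.
  by rewrite card_ord.
pose sg x := if `[< B0 (b x) >] then s else 1.
exists (phi (fibre_perm sg)) => [a B0a|[y _]].
  have [x _ bx] : range b a by rewrite rbB; apply: sB0B.
  rewrite -bx -phiE -(mulmorphJ phiM); congr phi.
  apply/conjg_fixP/commgP/permP=> -[w i].
  rewrite !permM !(right_translE, fibre_permE).
  suff -> : sg (w * x) = sg w by [].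
  rewrite /sg; congr (if _ then _ else _); apply/asbool_equiv_eq.
  rewrite bM bx; split=> [B0wa|B0w]; last exact: subgroupM.
  by rewrite -(mulgK a (b w)); apply: subgroupF.
rewrite -(phiE tau) -(phiE y) -(mulmorphR phiM) -(mulmorphX phiM).
rewrite -(mulmorphJ phiM) => /phi_inj.
rewrite commg_right_transl_fibre fibre_permX.
set d := fibre_perm _ => yE; apply/negP: s_neq1; rewrite negbK.
have := conjgC (right_transl _ tau) d; rewrite -yE => /permP dE.
have b1 : b 1 = 1 by apply: mulmorph1.
have sg1 : sg 1 = s by rewrite /sg b1 asboolT //; apply: subgroup1.
have sg_tau : sg tau = 1 by rewrite /sg asboolF.
have sg_tauV : sg tau^-1 = 1.
  rewrite /sg (mulmorphV bM) asboolF // => B0tV.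
  by apply: B0't; rewrite -[b tau]invgK; apply: subgroupV.
apply/eqP/permP=> i; move: (dE (1, i)).
rewrite !permM !(right_translE, fibre_permE) !mul1g mulgV sg1 sg_tau sg_tauV.
rewrite invg1 mulg1 mul1g => -[_ sME].
by rewrite expgnDr permM -sME -permM expVgn mulVg.
Qed.

(** In the permutations of [B], the left translations by [A] are a copy of
    [A] that commutes with the right translations; as a subgroup of [H] this
    copy is conjugate to [A]. *)
Lemma conjugate_into_centralizer (A B : set H) :
    subgroup A -> subgroup B -> finite_set B -> A `<=` B ->
  exists s, forall a, A a -> centralizer B (a ^ s).
Proof.
move=> gA gB finB sAB.
have [F [b [bM b_inj rbB]]] := finite_subgroup_range gB finB.
have [|phi [phiM phi_inj phiE]] :=
    permutation_model (I := unit) bM b_inj.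
  by rewrite card_unit.
pose bV y :=
  if pselect (exists x, b x = y) is left e then projT1 (cid e) else 1.
have bVK y : B y -> b (bV y) = y.
  rewrite -rbB /bV => -[x _ bx]; case: pselect => [e|[]]; last by exists x.
  by case: cid.
pose l a := phi (left_transl unit (bV a)).
have lM : {in A &, {morph l : a a' / a * a'}}.
  move=> a a'; rewrite !inE => Aa Aa'; rewrite /l -phiM -left_translM.
  congr (phi (left_transl _ _)); apply: b_inj.
  by rewrite bM !bVK //; apply: sAB => //; apply: subgroupM.
have l_inj : {in A &, injective l}.
  move=> a a'; rewrite !inE => Aa Aa' /phi_inj/permP/(_ (1, tt)).
  rewrite !left_translE !mulg1 => -[/invg_inj eqa].
  by rewrite -(bVK a (sAB _ Aa)) eqa bVK //; apply: sAB.
have glA : subgroup (l @` A).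
  have lF : {in A &, {morph l : a a' / a / a'}}.
    move=> a a' Aa Aa'; apply: (canRL (mulgK _)); rewrite -lM ?mulgVK //.
    by move: Aa Aa'; rewrite !inE; apply: subgroupF.
  apply/subgroupP; split=> [|_ _ [a Aa <-] [a' Aa' <-]].
    exists 1; first exact: subgroup1.
    by rewrite -(mulgV 1) lF ?mulgV // inE; apply: subgroup1.
  by exists (a / a'); [apply: subgroupF | rewrite lF ?inE].
have finA : finite_set A := sub_finite_set sAB finB.
have [||s lAs] := hall_conjugate hallH gA glA finA.
- exact: finite_image.
- by exists l => //; split=> // _ [a Aa <-]; exists a.
exists s => a Aa; have [a' Aa' <-] : (l @` A) (a ^ s) by rewrite lAs; exists a.
rewrite -rbB => _ [x _ <-]; rewrite -phiE /l -(mulmorphJ phiM); congr phi.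
apply/conjg_fixP/commgP/permP=> -[w i].
by rewrite !permM !(right_translE, left_translE) mulgA.
Qed.

End HallEmbeddings.

(** * Displacements of an outer automorphism *)

Section OuterAutomorphisms.
Variables (H : groupType) (hallH : is_hall_universal H).

Lemma double_centralizer (A : set H) (v : H) :
    subgroup A -> finite_set A -> (forall z, centralizer A z -> v ^ z = v) ->
  A v.
Proof.
move=> gA finA Cv; apply: contrapT => A'v.
have finB : finite_set (generated_subgroup (A `|` [set v])).
  by apply: hall_generated_finite => //; rewrite finite_setU; split.
have gB := subgroup_generated (A `|` [set v]).
have [|||z Cz] := free_centralizer (M := 1) hallH gA gB finB _ _ A'v.
- by move=> a Aa; apply: sub_generated; left.
- by apply: sub_generated; right.
- by [].
have /conjg_fixP/eqP-> := Cv z Cz.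
by rewrite expg1 conjg1; apply; apply: sub_generated; right.
Qed.

(** If [f] is outer, each conjugation by [a \in A] disagrees with [f] at
    some [w a]; let [B] contain [A] and these finitely many points. Choose
    [s] such that [A ^ s] commutes with [B]. On [C(A ^ s)], hence on [B],
    [f] is the conjugation by [v = s^-1 * f s]. As [f] is also trivial on
    [C(A)], [v] commutes with [C(A) :&: C(A ^ s)], so it lies in [<A, A ^
    s>] and acts on [B] as some [a \in A]: a contradiction at [w a]. *)
Lemma centralizer_fixed_inner (f : autType H) (A : set H) :
    subgroup A -> finite_set A -> (forall z, centralizer A z -> f z = z) ->
  Inn H f.
Proof.
move=> gA finA fixC; have fM := autM f; apply: contrapT => f_outer.
have /choice[w wP] a : exists x, f x <> x ^ a.
  apply: contrapT => /forallNP eq_f; apply: f_outer; exists a => //.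
  by apply: autP => x; have /contrapT-> := eq_f x.
pose B := generated_subgroup (A `|` w @` A).
have gB : subgroup B by apply: subgroup_generated.
have finB : finite_set B.
  apply: hall_generated_finite => //.
  by rewrite finite_setU; split=> //; apply: finite_image.
have sAB : A `<=` B by move=> a Aa; apply: sub_generated; left.
have [s sP] := conjugate_into_centralizer hallH gA gB finB sAB.
pose L := (conjg^~ s) @` A; pose R := generated_subgroup (A `|` L).
have finR : finite_set R.
  apply: hall_generated_finite => //.
  by rewrite finite_setU; split=> //; apply: finite_image.
pose v := s^-1 * f s.
(* d ^ s^-1 is fixed in particular when d centralizes A ^ s. *)
have fJ d : f (d ^ s^-1) = d ^ s^-1 -> f d = d ^ v.
  move=> fd; rewrite /v conjgM -fd -(mulmorphJ fM).
  by rewrite conjgKV.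
have Rv : R v.
  apply: double_centralizer (subgroup_generated _) finR _ => d Cd.
  apply: centralizer_sym; rewrite -fJ; last first.
    apply: fixC => a Aa; apply: (@conjg_inj _ s); rewrite conjJg conjgKV.
    by apply: Cd; apply: sub_generated; right; exists a.
  by apply: fixC; apply: centralizerS Cd => a Aa; apply: sub_generated; left.
(* The elements that act on B as some element of A: a subgroup containing both
   A and A ^ s. *)
pose K := [set u | exists2 a, A a & forall x, B x -> x ^ u = x ^ a].
have gK : subgroup K.
  apply/subgroupP; split; first by exists 1 => //; apply: subgroup1.
  move=> u u' [a Aa ua] [a' Aa' ua']; exists (a / a'); first exact: subgroupF.
  move=> x Bx; rewrite !conjgM ua //; set y := x ^ a.
  have By : B (y ^ a'^-1).
    apply: (subgroupJ gB); first by apply: (subgroupJ gB) => //; apply: sAB.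
    by apply: (subgroupV gB); apply: sAB.
  by apply: (canLR (conjgK _)); rewrite ua' // conjgKV.
have [a Aa va] : K v.
  apply: generated_sub Rv => // u [Au|[a Aa <-]]; first by exists u.
  exists 1 => [|x Bx]; first exact: subgroup1.
  by rewrite conjg1; apply: sP Bx.
have Bwa : B (w a) by apply: sub_generated; right; exists a.
apply: (wP a); rewrite -va //; apply: fJ; apply: fixC => b Ab.
apply: (@conjg_inj _ s); rewrite conjJg conjgKV.
by apply: centralizer_sym; apply: sP.
Qed.

Lemma hall_center_trivial (a : H) : (forall x, a ^ x = a) -> a = 1.
Proof.
move=> Za; apply: (@double_centralizer [set 1]) => //.
by apply/subgroupP; split=> // x y -> ->; apply: divg1.
Qed.

Section Displacement.
Variable f : autType H.

Definition invariant_subgroup (A : set H) : Prop :=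
  [/\ subgroup A, finite_set A & forall x, A (f x) <-> A x].

(** The factor by which conjugation by [k] changes [f]; see [aut_conj_inner]
    below. *)
Definition displacement k := (f k)^-1 * k.
Local Notation u := displacement.

Let fM := autM f.
Let f_inj : injective f := bij_inj (aut_bij f).

Lemma centralizer_invariant A z :
  invariant_subgroup A -> centralizer A z -> centralizer A (f z).
Proof.
move=> [_ _ fA] Cz a Aa; rewrite -(aut_invKV f a) -(mulmorphJ fM) Cz //.
by apply/fA; rewrite aut_invKV.
Qed.

Lemma centralizer_displacement A z :
  invariant_subgroup A -> centralizer A z -> centralizer A (u z).
Proof.
move=> fA Cz; have gC := subgroup_centralizer A.
apply: (subgroupM gC) => //; apply: (subgroupV gC).
exact: centralizer_invariant.
Qed.

Lemma displacement_mem A h : invariant_subgroup A -> A h -> A (u h).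
Proof.
case=> gA _ fA Ah; apply: (subgroupM gA) => //.
by apply: subgroupV => //; apply/fA.
Qed.

Lemma displacementMl A z h : invariant_subgroup A -> centralizer A z -> A h ->
  u (z * h) = u h * u z.
Proof.
move=> fA Cz Ah; have Cuz := centralizer_displacement fA Cz.
have uzh : u z * h = h * u z.
  by rewrite (conjgC (u z)) (centralizer_sym (Cuz h Ah)).
rewrite /displacement fM invMg -!mulgA; congr (_ * _).
by rewrite mulgA; exact: uzh.
Qed.

Hypothesis f_outer : ~ Inn H f.
Hypothesis f_inv : forall T, finite_set T ->
  exists2 A, invariant_subgroup A & T `<=` A.

(** A nontrivial displacement of an element of [C(A)] could still fall in
    the center of [A]. Using the centralizer of a larger [A1] with [C(A1)
    :&: A = 1] excludes this. *)
Lemma displacement_notin A : invariant_subgroup A ->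
  exists2 z, centralizer A z & ~ A (u z).
Proof.
move=> fA; have [gA finA _] := fA.
have /choice[w wP] : forall a : H, exists x, a <> 1 -> a ^ x <> a.
  move=> a; have [/hall_center_trivial a1|/existsNP[x ax]] :=
      pselect (forall x, a ^ x = a).
    by exists 1.
  by exists x.
have [|A1 fA1 sA1] := f_inv (T := A `|` w @` A).
  by rewrite finite_setU; split=> //; apply: finite_image.
have [gA1 finA1 _] := fA1.
have [z Cz fz] : exists2 z, centralizer A1 z & f z <> z.
  apply: contrapT => nz; apply: f_outer.
  apply: centralizer_fixed_inner finA1 _ => // z Cz.
  by apply: contrapT => fz; apply: nz; exists z.
exists z => [|Auz]; first by apply: centralizerS Cz => a Aa; apply: sA1; left.
have [|uz1] := pselect (u z = 1).
  by move/(canRL (mulKg _)); rewrite invgK mulg1 => /esym.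
apply: (wP _ uz1); apply: centralizer_sym.
apply: centralizer_displacement Cz _ _ => //.
by apply: sA1; right; exists (u z).
Qed.

(** Plain displacements do not suffice: an involution [f] inverts each of
    them. If the claim failed, the choice [z1 = z0 * c], [z2 = c], for which
    [t = u z0 ^ c], would give [f (u z0) ^ (f c / c) \in <A, u z0>] for all
    [c \in C(A)]; by finiteness every [u c] would then normalize this
    subgroup. *)
Lemma displacement_quotient_escapes A : invariant_subgroup A ->
  exists z1 z2, [/\ centralizer A z1, centralizer A z2 &
    let t := (u z2)^-1 * u z1 in ~ generated_subgroup (A `|` [set t]) (f t)].
Proof.
move=> fA; have [gA finA Af] := fA; apply: contrapT => all_norm.
have [z0 Cz0 A'u0] := displacement_notin fA.
have gC := subgroup_centralizer A.
pose Q := generated_subgroup (A `|` [set u z0]).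
have gQ : subgroup Q by apply: subgroup_generated.
have finQ : finite_set Q.
  by apply: hall_generated_finite => //; rewrite finite_setU.
have sAQ : A `<=` Q by move=> a Aa; apply: sub_generated; left.
have Qu0 : Q (u z0) by apply: sub_generated; right.
have uJ c : (u c)^-1 * u (z0 * c) = u z0 ^ c.
  by rewrite /u fM !invMg invgK conjgE !mulgA mulgK.
have QfJ c x : centralizer A c -> Q x -> Q (f x ^ (f c / c)).
  move=> Cc; have Cd : centralizer A (f c / c).
    by apply: (subgroupF gC) => //; apply: centralizer_invariant.
  have jM : {morph (fun x => f x ^ (f c / c)) : x y / x * y}.
    by move=> y y'; rewrite fM conjMg.
  move: x; apply: generated_sub (subgroup_preimage jM gQ) _ => x [Ax|->] /=.
    by rewrite Cd; [apply: sAQ|]; apply/Af.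
  (* u z0 ^ c has the form (u z2)^-1 * u z1, so it is covered by all_norm. *)
  have cM : {morph (fun x => x ^ c^-1) : x y / x * y}.
    by move=> y y'; rewrite conjMg.
  rewrite conjgM -(mulmorphJ fM).
  suff : generated_subgroup (A `|` [set u z0 ^ c]) (f (u z0 ^ c)).
    apply: generated_sub (subgroup_preimage cM gQ) _ _ => y [Ay|->] /=.
      by rewrite (subgroupV gC Cc) //; apply: sAQ.
    by rewrite conjgK.
  apply: contrapT => nQ; apply: all_norm; exists (z0 * c), c.
  by split=> //=; [apply: (subgroupM gC) | rewrite uJ].
have Qf x : Q x -> Q (f x).
  by move/(QfJ 1 _ (subgroup1 gC)); rewrite divg1 (mulmorph1 fM) conjg1.
(* The displacement of c is f c' / c' for c' := c^-1. *)
have QJu c x : centralizer A c -> Q x -> Q (x ^ u c).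
  move=> Cc /(finite_injection_onto finQ f_inj Qf)[y Qy <-].
  by have := QfJ _ y (subgroupV gC Cc) Qy; rewrite (mulmorphV fM) invgK.
have QJuV c x : centralizer A c -> Q x -> Q (x ^ (u c)^-1).
  move=> Cc /(finite_injection_onto finQ (@conjg_inj _ (u c)))[].
    by move=> y; apply: QJu.
  by move=> y Qy <-; rewrite conjgK.
have [//|z Cz] := free_centralizer (M := 1) hallH gA gQ finQ sAQ Qu0 A'u0.
apply; rewrite expg1.
have -> : [~ u z0, z] = (u z0)^-1 * ((u z)^-1 * u (z0 * z)).
  by rewrite uJ.
rewrite (conjgM _ (u z0)^-1) (conjgM _ (u z)^-1); apply: QJu.
  exact: (subgroupM gC).
by apply: QJuV => //; apply: (subgroupJ gQ) => //; apply: (subgroupV gQ).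
Qed.

(** The approximations [h1], [h2], [h3] are put in [A] and the [ki] are
    sought in [C(A) * hi]. The commutator is then the product of the one for
    elements of [C(A)] and of one lying in [A], which commute; this reduces
    the problem to [C(A)]. *)
Lemma displacement_commutator_order (S : set H) (h1 h2 h3 : H) M :
    finite_set S -> 0 < M ->
  exists k1 k2 k3 : H,
    (forall a, S a ->
      [/\ a ^ k1 = a ^ h1, a ^ k2 = a ^ h2 & a ^ k3 = a ^ h3]) /\
    [~ (u k2)^-1 * u k1, u k3] ^+ M <> 1.
Proof.
move=> finS M_gt0.
have [|A fA sA] := f_inv (T := S `|` [set h1; h2; h3]).
  by rewrite finite_setU; split=> //; apply: finite_set3.
have [gA finA Af] := fA.
have [Ah1 Ah2 Ah3] : [/\ A h1, A h2 & A h3].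
  by split; apply: sA; right; [left; left | left; right | right].
have [z1 [z2 [Cz1 Cz2]]] := displacement_quotient_escapes fA.
set t := _^-1 * _ => /= nt.
have gC := subgroup_centralizer A.
have Ct : centralizer A t.
  by apply: (subgroupM gC); first apply: (subgroupV gC);
     apply: centralizer_displacement.
pose x := aut_inv f t; have fx : f x = t by rewrite aut_invKV.
pose B0 := generated_subgroup (A `|` [set x]).
have B0't : ~ B0 t.
  suff sB0 : B0 `<=` f @^-1` generated_subgroup (A `|` [set t]) by move/sB0.
  apply: generated_sub; first exact: subgroup_preimage (subgroup_generated _).
  by move=> y [Ay|->] /=; apply: sub_generated; [left; apply/Af | right].
pose B := generated_subgroup (A `|` [set x] `|` [set t]).
have finB : finite_set B.
  by apply: hall_generated_finite => //; rewrite !finite_setU.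
have Bt : B t by apply: sub_generated; right.
have sB0B : B0 `<=` B.
  apply: generated_sub (subgroup_generated _) _ => y B0y.
  by apply: sub_generated; left.
have [z3 C0z3 BJ] := free_centralizer hallH
  (subgroup_generated _) (subgroup_generated _) finB sB0B Bt B0't M_gt0.
have Cz3 : centralizer A z3.
  by apply: centralizerS C0z3 => a Aa; apply: sub_generated; left.
(* f z3 centralizes f x = t because z3 centralizes x. *)
have tJ : t ^ u z3 = t ^ z3.
  rewrite /u conjgM; congr (_ ^ _); apply: (canLR (conjgK _)).
  by rewrite -{2}fx -(mulmorphJ fM) C0z3 ?fx //; apply: sub_generated; right.
have agree z h a : centralizer A z -> S a -> a ^ (z * h) = a ^ h.
  by move=> Cz Sa; rewrite conjgM Cz //; apply: sA; left.
exists (z1 * h1), (z2 * h2), (z3 * h3); split=> [a Sa|].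
  by split; apply: agree.
rewrite !(displacementMl fA) //; have Amem h := displacement_mem (h := h) fA.
have -> : (u h2 * u z2)^-1 * (u h1 * u z1) = ((u h2)^-1 * u h1) * t.
  have Cu : centralizer A (u z2)^-1.
    by apply: (subgroupV gC); apply: centralizer_displacement.
  have Ab : A ((u h2)^-1 * u h1).
    by apply: (subgroupM gA); [apply: (subgroupV gA) |]; apply: Amem.
  have ub : (u z2)^-1 * ((u h2)^-1 * u h1) = (u h2)^-1 * u h1 * (u z2)^-1.
    by rewrite (conjgC (u z2)^-1) (centralizer_sym (Cu _ Ab)).
  by rewrite invMg mulgA -(mulgA (u z2)^-1) ub -mulgA.
set b := _^-1 * _.
have Ab : A b.
  by apply: (subgroupM gA); [apply: (subgroupV gA) |]; apply: Amem.
have Cu3 := centralizer_displacement fA Cz3.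
rewrite (commgMM_centralizer Ab (Amem _ Ah3) Ct Cu3).
have Cc : centralizer A [~ t, u z3].
  exact: (subgroupR gC).
set c := [~ b, _]; have Ac : A c by apply: (subgroupR gA) => //; apply: Amem.
rewrite expgMn; last by apply/commgP/conjg_fixP; apply: Cc.
(* Otherwise the power of [~ t, z3] would lie in A and centralize t. *)
move/mulg1_eq => cE; apply: BJ.
rewrite commgEl -tJ -commgEl -cE.
rewrite (centralizer_sym (Ct _ _)) //.
by apply: (subgroupV gA); apply: (subgroupX _ gA).
Qed.

End Displacement.
End OuterAutomorphisms.

(** * Automorphisms as limits of inner ones *)

Section GenericAutomorphisms.
Variable H : groupType.

Lemma inner_autM : {morph @inner_aut H : a b / a * b}.
Proof. by move=> a b; apply: autP => x /=; rewrite conjgM. Qed.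

Lemma inner_autJ a (g : autType H) : inner_aut a ^ g = inner_aut (g a).
Proof.
apply: autP => x; rewrite /= (mulmorphJ (autM g)); congr (_ ^ _).
exact: aut_invKV.
Qed.

Lemma aut_conj_inner (f : autType H) k :
  f ^ inner_aut k = f * inner_aut (displacement f k).
Proof.
rewrite conjgE -(mulmorphV inner_autM); apply: autP => x /=.
by rewrite (mulmorphJ (autM f)) (mulmorphV (autM f)) conjgM.
Qed.

Lemma normal_Inn : normal_subgroup (Inn H).
Proof.
split=> [|_ g [a _ <-]]; first exact: subgroup_range inner_autM.
by exists (g a) => //; rewrite inner_autJ.
Qed.

Section LocallyDetermined.
Variable I : finType.
Implicit Types Psi Phi : (I -> autType H) -> autType H.

(** Continuity for the topology of pointwise convergence on [Aut H], where
    [H] is discrete. *)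
Definition locally_determined Psi := forall (g : I -> autType H) x,
  exists s : seq H, forall g' : I -> autType H,
    (forall i b, b \in s -> g' i b = g i b) -> Psi g' x = Psi g x.

Lemma locally_determined_cst f : locally_determined (fun=> f).
Proof. by move=> g x; exists [::]. Qed.

Lemma locally_determined_proj i : locally_determined (fun g => g i).
Proof. by move=> g x; exists [:: x] => g'; apply; rewrite mem_head. Qed.

Lemma locally_determinedM Psi Phi :
    locally_determined Psi -> locally_determined Phi ->
  locally_determined (fun g => Psi g * Phi g).
Proof.
move=> lPsi lPhi g x; have [s sP] := lPsi g x.
have [s' s'P] := lPhi g (Psi g x).
exists (s ++ s') => g' gg' /=; rewrite sP ?s'P // => i b bs; apply: gg';
  by rewrite mem_cat bs ?orbT.
Qed.

Lemma locally_determinedV Psi :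
  locally_determined Psi -> locally_determined (fun g => (Psi g)^-1).
Proof.
move=> lPsi g x; pose y := (Psi g)^-1 x; have [s sP] := lPsi g y.
have yE : Psi g y = x by apply: aut_invKV.
by exists s => g' /sP gg'; rewrite -/y -yE -gg'; apply: aut_invK.
Qed.

Lemma locally_determinedJ Psi Phi :
    locally_determined Psi -> locally_determined Phi ->
  locally_determined (fun g => Psi g ^ Phi g).
Proof.
move=> lPsi lPhi; apply: locally_determinedM; first exact: locally_determinedV.
exact: locally_determinedM.
Qed.

Lemma locally_determinedR Psi Phi :
    locally_determined Psi -> locally_determined Phi ->
  locally_determined (fun g => [~ Psi g, Phi g]).
Proof.
move=> lPsi lPhi; apply: locally_determinedM; first exact: locally_determinedV.
exact: locally_determinedJ.
Qed.

Lemma locally_determinedX Psi n :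
  locally_determined Psi -> locally_determined (fun g => Psi g ^+ n).
Proof.
move=> lPsi; elim: n => [|n IHn]; first exact: locally_determined_cst.
rewrite (_ : (fun g => _) = (fun g => Psi g * Psi g ^+ n)).
  exact: locally_determinedM.
by apply/funext=> g; rewrite expgS.
Qed.

(** The finite approximations of [g] are pairs of a finite set [s] and a
    family [k], standing for the restrictions to [s] of conjugation by [k
    i]. Requirement [R n] is met at step [n], by a refinement that forces it
    for every extension; countability of [H] allows every element of [H] to
    enter both the domain and the range. *)
Lemma generic_automorphisms (R : nat -> (I -> autType H) -> Prop) :
    countable [set: H] ->
    (forall n (s : seq H) (h : I -> H), exists k : I -> H, exists s' : seq H,
       (forall i a, a \in s -> a ^ k i = a ^ h i) /\
       forall g : I -> autType H,
         (forall i b, b \in s' -> g i b = b ^ k i) -> R n g) ->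
  exists g, forall n, R n g.
Proof.
move=> /countable_injP[f f_inj] dense.
have /choice[e eP] : forall n, exists x : H, forall y, f y = n -> x = y.
  move=> n; have [[x <-]|nx] := pselect (exists x, f x = n).
    by exists x => y fyx; apply: f_inj; rewrite ?inE.
  by exists 1 => y fy; case: nx; exists y.
pose P n (st st' : seq H * (I -> H)) :=
  [/\ forall i a, a \in st.1 -> a ^ st'.2 i = a ^ st.2 i,
      {subset st.1 <= st'.1}, e n \in st'.1,
      forall i, e n ^ (st'.2 i)^-1 \in st'.1 &
      forall g : I -> autType H,
        (forall i b, b \in st'.1 -> g i b = b ^ st'.2 i) -> R n g].
have /choice[F FP] :
    forall p : nat * (seq H * (I -> H)), exists st', P p.1 p.2 st'.
  move=> [n [s h]]; have [k [s' [kP s'P]]] := dense n s h.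
  exists (e n :: s ++ s' ++ [seq e n ^ (k i)^-1 | i : I], k).
  split=> //= [a sa||i|g gP]; rewrite ?inE ?mem_cat ?eqxx ?sa ?orbT //.
  - by rewrite (fintype.image_f (fun i => e n ^ (k i)^-1)) ?orbT.
  - by apply: s'P => i b bs'; apply: gP; rewrite inE !mem_cat bs' !orbT.
pose st n := iteri n (fun n st => F (n, st)) ([::], fun=> 1).
have stP n : P n (st n) (st n.+1) by apply: (FP (n, st n)).
have mono n m : n <= m -> {subset (st n).1 <= (st m).1} /\
    forall i a, a \in (st n).1 -> a ^ (st m).2 i = a ^ (st n).2 i.
  elim: m => [|m IHm]; first by rewrite leqn0 => /eqP->.
  rewrite leq_eqVlt ltnS => /orP[/eqP->|/IHm[sub kE]]; first by split.
  have [kE' sub' _ _ _] := stP m; split=> [a /sub/sub' //|i a sa].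
  by rewrite kE' ?kE //; apply: sub.
have /choice[N NP] : forall x, exists n, x \in (st n).1.
  move=> x; exists (f x).+1; have [_ _ + _ _] := stP (f x).
  by rewrite (eP _ x).
pose g i x := x ^ (st (N x)).2 i.
have gE i x n : x \in (st n).1 -> g i x = x ^ (st n).2 i.
  move=> sx; have [_ E1] := mono _ _ (leq_maxl n (N x)).
  by have [_ E2] := mono _ _ (leq_maxr n (N x)); rewrite /g -E2 ?E1.
have upto x y z :
    exists n, [/\ x \in (st n).1, y \in (st n).1 & z \in (st n).1].
  exists (maxn (N x) (maxn (N y) (N z))).
  by split; apply: (mono (N _) _ _).1 (NP _); rewrite !leq_max leqnn ?orbT.
have gM i : {morph g i : x y / x * y}.
  move=> x y; have [n [sx sy sxy]] := upto x y (x * y).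
  by rewrite !(gE _ _ n) ?conjMg.
have g_inj i : injective (g i).
  move=> x y; have [n [sx sy _]] := upto x y y.
  by rewrite !(gE _ _ n) // => /conjg_inj.
have g_surj i y : exists x, g i x = y.
  have [_ _ _ sy _] := stP (f y); rewrite (eP _ y) // in sy.
  by exists (y ^ ((st (f y).+1).2 i)^-1); rewrite (gE _ _ _ (sy i)) conjgKV.
have g_bij i : bijective (g i).
  have /choice[gV gVK] := g_surj i.
  by exists gV => // x; apply: (g_inj i).
exists (fun i => MkAut (gM i) (g_bij i)) => n.
by have [_ _ _ _] := stP n; apply=> i b; apply: gE.
Qed.

End LocallyDetermined.
End GenericAutomorphisms.

(** * The locally finite radical *)

Lemma aut_expE (G : groupType) (f : autType G) n x : (f ^+ n) x = iter n f x.
Proof. by elim: n x => [//|n IHn] x; rewrite expgSr /= IHn. Qed.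

Section HallRadical.
Variables (H : groupType) (hallH : is_hall_universal H).

Lemma locally_finite_Inn : locally_finite (Inn H).
Proof.
move=> _ [S finS ->] sInn.
have /choice[a aP] : forall g : autType H, exists a, Inn H g -> inner_aut a = g.
  move=> g; have [[a _ <-]|nInn] := pselect (Inn H g); last by exists 1.
  by exists a.
apply: (@sub_finite_set _ _ (@inner_aut H @` generated_subgroup (a @` S))).
  apply: generated_sub.
    by apply: (subgroup_image (@inner_autM H)); apply: subgroup_generated.
  move=> g Sg; exists (a g); first by apply: sub_generated; exists g.
  by apply: aP; apply: sInn; apply: sub_generated.
by apply: finite_image; apply: hall_generated_finite => //; apply: finite_image.
Qed.

(** The finitely many iterates of [f] move a finite set to a finite set. *)
Lemma torsion_invariant_subgroup (f : autType H) n (T : set H) :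
    0 < n -> f ^+ n = 1 -> finite_set T ->
  exists2 A, invariant_subgroup f A & T `<=` A.
Proof.
move=> n_gt0 fn1 finT.
pose S := [set y | exists2 x, T x & exists i, y = iter i f x].
have fnE x : iter n f x = x by rewrite -aut_expE fn1.
have fmod i x : iter i f x = iter (i %% n) f x.
  rewrite {1}(divn_eq i n) addnC iterD; congr (iter _ _ _).
  by elim: (i %/ n) => //= q IHq; rewrite mulSn iterD IHq fnE.
have finS : finite_set S.
  apply: (@sub_finite_set _ _ ((fun p => iter p.1 f p.2) @` (`I_n `*` T))).
    move=> _ [x Tx [i ->]]; exists (i %% n, x) => /=; last by rewrite -fmod.
    by split=> //=; rewrite ltn_mod.
  by apply: finite_image; apply: finite_setX => //; apply: finite_II.
pose A := generated_subgroup S.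
have fA x : A x -> A (f x).
  move: x; apply: generated_sub.
    exact: (subgroup_preimage (autM f) (subgroup_generated _)).
  move=> _ [x Tx [i ->]] /=; apply: sub_generated.
  by exists x => //; exists i.+1.
exists A; last by move=> x Tx; apply: sub_generated; exists x => //; exists 0.
split; [exact: subgroup_generated | exact: hall_generated_finite | ].
move=> x; split=> [Afx|]; last exact: fA.
rewrite -[x]fnE -(prednK n_gt0) iterSr.
by elim: n.-1 => //= i; apply: fA.
Qed.

(** The candidate is a commutator of quotients of conjugates of [f] by
    generic automorphisms. That a given power of it is nontrivial is
    witnessed by finitely many values of these automorphisms, and
    [displacement_commutator_order] says that every finite approximation can
    be refined to make it so. *)
Lemma normal_infinite_order (N : set (autType H)) (f : autType H) :
    normal_subgroup N -> locally_finite N -> N f -> ~ Inn H f ->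
  exists2 g, N g & forall n, 0 < n -> g ^+ n <> 1.
Proof.
move=> [gN nN] lfN Nf f_outer.
have [m m_gt0 fm1] := locally_finite_torsion gN lfN Nf.
have f_inv T := torsion_invariant_subgroup (T := T) m_gt0 fm1.
pose i0 : 'I_3 := @Ordinal 3 0 isT; pose i1 : 'I_3 := @Ordinal 3 1 isT.
pose i2 : 'I_3 := @Ordinal 3 2 isT.
pose W (g : 'I_3 -> autType H) :=
  [~ (f ^ g i1)^-1 * f ^ g i0, f^-1 * f ^ g i2].
have lJ i : locally_determined (fun g : 'I_3 -> autType H => f ^ g i).
  apply: locally_determinedJ; first exact: locally_determined_cst.
  exact: locally_determined_proj.
have lW n : locally_determined (fun g => W g ^+ n).
  apply/locally_determinedX/locally_determinedR.
    by apply: locally_determinedM => //; apply: locally_determinedV.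
  by apply: locally_determinedM => //; apply: locally_determined_cst.
have W_inner (k : 'I_3 -> H) : W (fun i => inner_aut (k i)) =
    inner_aut [~ (displacement f (k i1))^-1 * displacement f (k i0),
                 displacement f (k i2)].
  have iM := @inner_autM H.
  rewrite /W !aut_conj_inner invMg -mulgA !mulKg.
  by rewrite -(mulmorphV iM) -iM -(mulmorphR iM).
have [|n s h|g gP] :=
    @generic_automorphisms H 'I_3 (fun n g => W g ^+ n.+1 <> 1).
- exact: hall_countable hallH.
- have [k1 [k2 [k3 [kP WnE]]]] :=
    displacement_commutator_order hallH f_outer f_inv
      (h i0) (h i1) (h i2) (finite_seq s) (ltn0Sn n).
  pose k (i : 'I_3) := nth 1 [:: k1; k2; k3] i.
  have Wk : W (fun i => inner_aut (k i)) ^+ n.+1 <> 1.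
    rewrite W_inner -(mulmorphX (@inner_autM H)) => WnE1.
    apply: WnE; apply: (hall_center_trivial hallH) => x.
    apply: centralizer_sym.
    exact: (congr1 (fun g : autType H => g x) WnE1).
  have [x Wx] : exists x, (W (fun i => inner_aut (k i)) ^+ n.+1) x <> x.
    apply: contrapT => /forallNP nx; apply: Wk.
    by apply: autP => x; have /contrapT := nx x.
  have [s' s'P] := lW n.+1 (fun i => inner_aut (k i)) x.
  exists k, s'; split=> [i a sa|g gk W1].
    have [E0 E1 E2] := kP a sa.
    by case: i => -[|[|[|//]]] lt_i; rewrite /k /=;
       [rewrite E0 | rewrite E1 | rewrite E2]; congr (_ ^ h _); apply: val_inj.
  by apply: Wx; rewrite -(s'P g) ?W1.
- exists (W g) => [|[//|n] _]; last exact: gP.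
  have NJ i : N (f ^ g i) by apply: nN.
  by apply: (subgroupR gN); apply: (subgroupM gN) => //; apply: (subgroupV gN).
Qed.

End HallRadical.

Theorem theorem3 (H : groupType) (hallH : is_hall_universal H) :
  is_locally_finite_radical (Inn H).
Proof.
split; [exact: normal_Inn | exact: locally_finite_Inn | move=> N nN lfN f Nf].
apply: contrapT => f_outer.
have [g Ng g_infinite] := normal_infinite_order hallH nN lfN Nf f_outer.
have [n n_gt0] := locally_finite_torsion nN.1 lfN Ng.
exact: g_infinite.
Qed.
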